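(* Let $n\ge 2$ be an integer and let $A$ be $n$-good. Then for Lebesgue-almost every $z\in[0,2]$ there is a continuum of representations $z=x+y$ with $x,y\in C_A$; that is, the set $\{(x,y)\in C_A\times C_A : x+y=z\}$ has the cardinality of the continuum.
   Context: For an integer $n\ge 2$ and a set $A$ of integers with $0,n-1\in A\subset\{0,1,\dots,n-1\}$, $C_A=C_{A,n}=\left\{\sum_{i=1}^\infty a_i n^{-i} : a_i\in A\right\}$, which is the attractor of the iterated function system $\{x\mapsto (x+a)/n : a\in A\}$. The sign $+$ between sets denotes the Minkowski sum. The set $A$ is called $n$-good if $0,n-1\in A\subset\{0,1,\dots,n-1\}$ and $C_A+C_A=[0,2]$. *)

(* Defs.v *)
From HB Require Import structures.
From mathcomp Require Import all_boot all_order all_algebra.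
From mathcomp Require Import all_classical all_reals all_analysis.
Import Order.TTheory GRing.Theory Num.Theory.
Import numFieldNormedType.Exports.

Set Implicit Arguments.
Unset Strict Implicit.
Unset Printing Implicit Defensive.

Local Open Scope classical_set_scope.
Local Open Scope ring_scope.

(* The digit sequence is indexed from 0, so a_(i+1) of the usual numbering is
   a i and it carries the weight n^-(i+1). *)
Definition cantor_sum_set (R : realType) (n : nat) (A : set int) : set R :=
  [set x | exists a : nat -> int, (forall i, A (a i)) /\
    series (fun i => (a i)%:~R * n%:R ^- i.+1 : R) @ \oo --> x].
Arguments cantor_sum_set : clear implicits.

Definition minkowski_sum (R : realType) (X Y : set R) : set R :=
  [set x + y | x in X & y in Y].

Definition digit_set (n : nat) (A : set int) : Prop :=
  [/\ A 0, A (n%:Z - 1) & A `<=` [set a | 0 <= a <= n%:Z - 1]].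

Definition n_good (R : realType) (n : nat) (A : set int) : Prop :=
  digit_set n A /\
  minkowski_sum (cantor_sum_set R n A) (cantor_sum_set R n A) = `[0, 2]%classic.
Arguments n_good : clear implicits.

Definition representations (R : realType) (n : nat) (A : set int) (z : R)
    : set (R * R) :=
  [set p | [/\ cantor_sum_set R n A p.1, cantor_sum_set R n A p.2
             & p.1 + p.2 = z]].

(* Main.v *)
Require Import Defs.
From HB Require Import structures.
From mathcomp Require Import all_boot all_order all_algebra.
From mathcomp Require Import all_classical all_reals all_analysis.
From mathcomp Require Import ring lra zify.
Import Order.TTheory GRing.Theory Num.Theory.
Import numFieldNormedType.Exports.
Local Open Scope classical_set_scope.
Local Open Scope ring_scope.

(** Write z = x + y with x and y in C_A, and let a and b be their digit
sequences.  Exchanging a i and b i at any set of positions i leaves x + y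
unchanged.  If a and b differ at infinitely many positions, exchanging along
the subsets of every other such position gives a family of representations
indexed by the binary sequences.  It is injective: two sequences of digits in
{0, ..., n-1} with the same sum differ at every position from their first
difference onwards ([radix_zero_rigid]), whereas the positions left out are
never exchanged.  If a and b agree from some position on, x - y is a finite
sum, hence rational.  So a single representation with x - y irrational already
yields a continuum of them ([irrational_difference_continuum]).

It remains to find such a representation for almost every z.
- If some digit c is missing from A, C_A is covered by (n-1)^k intervals of
  length 2 n^-k for every k and is null ([cantor_content_zero]).  A point z
  having a representation with x - y = q rational is 2 x - q, so it lies in
  the union over the rationals q of the null sets 2 C_A - q
  ([rational_difference_negligible]).  Outside this union, any representation
  provided by C_A + C_A = [0, 2] will do.
- If A contains every digit, C_A contains every x with 0 <= x < 1, and
  for 0 < z < 2 one takes x = (z + t) / 2 and y = (z - t) / 2 with t a small irrational number. *)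

(** * Series of digits in base n *)

Definition radix_series (R : realType) (n : nat) (d : nat -> int) : R ^nat :=
  series (fun i => (d i)%:~R * n%:R ^- i.+1 : R).

(** Negative digits are allowed so that the difference of two sequences of
ordinary digits is again such a sequence. *)
Definition base_digits (n : nat) (d : nat -> int) := forall i, `|d i| <= n%:Z - 1.

(** The k-th partial sum is a fraction over n^k, and this is its numerator; it
turns statements on partial sums into integer arithmetic. *)
Fixpoint radix_numerator (n : nat) (d : nat -> int) (k : nat) : int :=
  if k is k'.+1 then n%:Z * radix_numerator n d k' + d k' else 0.

Lemma radix_series0 (R : realType) n d : radix_series R n d 0 = 0.
Proof. by rewrite /radix_series /series /= big_geq. Qed.

Lemma radix_seriesS (R : realType) n d k :
  radix_series R n d k.+1 = radix_series R n d k + (d k)%:~R * n%:R ^- k.+1.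
Proof. by rewrite /radix_series seriesSr. Qed.

Lemma radix_numeratorE (R : realType) n d k : (0 < n)%N ->
  radix_series R n d k = (radix_numerator n d k)%:~R * n%:R ^- k.
Proof.
move=> n0; have nR : n%:R != 0 :> R by rewrite pnatr_eq0 -lt0n.
elim: k => [|k IH]; first by rewrite /radix_series /series /= big_geq// mul0r.
rewrite radix_seriesS IH /= rmorphD rmorphM /= mulrDl exprS invfM.
rewrite -pmulrn; congr (_ + _).
by rewrite mulrACA divff // mul1r.
Qed.

(** The bound telescopes, so that the partial sums plus and minus n^-k are
monotone; convergence and the estimate of the remainder both follow. *)
Lemma radix_increment (R : realType) n d k : (0 < n)%N -> base_digits n d ->
  `|radix_series R n d k.+1 - radix_series R n d k|
    <= n%:R ^- k - n%:R ^- k.+1.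
Proof.
move=> n0 dn; have nR : 0 < n%:R :> R by rewrite ltr0n.
rewrite radix_seriesS addrC addKr normrM [`|_ ^- _|]ger0_norm; last first.
  by rewrite invr_ge0 exprn_ge0 // ltW.
have -> : n%:R ^- k - n%:R ^- k.+1 = (n%:Z - 1)%:~R * n%:R ^- k.+1 :> R.
  by rewrite rmorphB /= -pmulrn exprS invfM mulrBl mul1r mulrA divff ?gt_eqF// mul1r.
rewrite ler_pM2r ?invr_gt0 ?exprn_gt0 //.
by rewrite -intr_norm ler_int.
Qed.

Lemma radix_upper_noninc (R : realType) n d : (0 < n)%N -> base_digits n d ->
  {homo (fun k => radix_series R n d k + n%:R ^- k) : j k / (j <= k)%N >-> k <= j}.
Proof.
move=> n0 dn; apply/nonincreasing_seqP => k.
have := @radix_increment R n d k n0 dn; rewrite ler_norml; lra.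
Qed.

Lemma radix_lower_nondec (R : realType) n d : (0 < n)%N -> base_digits n d ->
  {homo (fun k => radix_series R n d k - n%:R ^- k) : j k / (j <= k)%N >-> j <= k}.
Proof.
move=> n0 dn; apply/nondecreasing_seqP => k.
have := @radix_increment R n d k n0 dn; rewrite ler_norml; lra.
Qed.

Lemma cvg_radix_weight (R : realType) n : (1 < n)%N ->
  n%:R ^- k @[k --> \oo] --> (0 : R).
Proof.
move=> n1; have := @cvg_geometric R 1 n%:R^-1.
rewrite ger0_norm ?invr_ge0 // invf_lt1 ?ltr1n ?ltr0n ?(ltnW n1) // => /(_ n1).
by apply: cvg_trans; apply: near_eq_cvg; near=> k; rewrite /= mul1r exprVn.
Unshelve. all: by end_near. Qed.

Lemma is_cvg_radix_series (R : realType) n d : (1 < n)%N -> base_digits n d ->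
  cvgn (radix_series R n d).
Proof.
move=> n1 dn; have n0 := ltnW n1; have lo := @radix_lower_nondec R n d n0 dn.
have w0 k : 0 <= n%:R ^- k :> R by rewrite invr_ge0 exprn_ge0.
have cl : cvgn (fun k => radix_series R n d k - n%:R ^- k).
  apply: nondecreasing_is_cvgn lo _; exists 1 => _ [k _ <-].
  have := @radix_upper_noninc R n d n0 dn 0 k isT.
  rewrite /= radix_series0 expr0 invr1.
  have := w0 k; lra.
rewrite [X in cvgn X](_ : _ = (fun k => radix_series R n d k - n%:R ^- k) \+
  (fun k => n%:R ^- k)).
  by apply: is_cvgD cl _; apply/cvg_ex; exists 0; exact: cvg_radix_weight.
by apply/funext => k /=; rewrite subrK.
Qed.

Lemma radix_remainder (R : realType) n d (x : R) k : (1 < n)%N -> base_digits n d ->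
  radix_series R n d @ \oo --> x -> `|x - radix_series R n d k| <= n%:R ^- k.
Proof.
move=> n1 dn dx; have n0 := ltnW n1; have w := @cvg_radix_weight R n n1.
have cu : (fun k => radix_series R n d k + n%:R ^- k) @ \oo --> x.
  by rewrite -[x]addr0; apply: cvgD.
have cl : (fun k => radix_series R n d k - n%:R ^- k) @ \oo --> x.
  by rewrite -[x]subr0; apply: cvgB.
have := nonincreasing_cvgn_ge (@radix_upper_noninc R n d n0 dn) (cvgP _ cu) k.
have := nondecreasing_cvgn_le (@radix_lower_nondec R n d n0 dn) (cvgP _ cl) k.
rewrite (cvg_lim _ cu)// (cvg_lim _ cl)// ler_norml; lra.
Qed.

(** Since the sum is 0, the remainder estimate confines the numerators D_k to
{-1, 0, 1}.  A nonzero digit makes the next numerator nonzero, and then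
D_(k+1) = n D_k + d_k with |d_k| <= n - 1 can only stay in {-1, 0, 1} if
d_k = - (n - 1) D_k, which is nonzero and gives D_(k+1) = D_k. *)
Lemma radix_zero_rigid (R : realType) n d i : (1 < n)%N -> base_digits n d ->
  radix_series R n d @ \oo --> (0 : R) -> d i != 0 ->
  forall j, (i <= j)%N -> d j != 0.
Proof.
move=> n1 dn d0 di; have n0 := ltnW n1.
have small k : `|radix_numerator n d k| <= 1.
  have := @radix_remainder R n d 0 k n1 dn d0.
  rewrite sub0r normrN radix_numeratorE // normrM [`|_ ^- _|]ger0_norm; last first.
    by rewrite invr_ge0 exprn_ge0.
  rewrite -ler_pdivlMr ?invr_gt0 ?exprn_gt0 ?ltr0n // divff; last first.
    by rewrite invr_eq0 expf_neq0 // pnatr_eq0 -lt0n.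
  by rewrite -intr_norm -[1]/(1%:~R) ler_int.
have three k : [\/ radix_numerator n d k = -1, radix_numerator n d k = 0
    | radix_numerator n d k = 1].
  have := small k; set D := radix_numerator n d k => {}D1.
  suff : D = -1 \/ D = 0 \/ D = 1.
    by case=> [|[]] ?; [constructor 1|constructor 2|constructor 3].
  lia.
have nz k : d k != 0 -> radix_numerator n d k.+1 != 0.
  by move=> dk /=; have := dn k; case: (three k) => ->; lia.
have key k : radix_numerator n d k != 0 -> d k != 0 /\ radix_numerator n d k.+1 != 0.
  by move=> Dk; have := small k.+1; have := dn k => /=; case: (three k) Dk => ->; lia.
suff H m : radix_numerator n d (i + m).+1 != 0.
  move=> j; rewrite leq_eqVlt => /orP[/eqP <- //|ij].
  have := H (j - i.+1)%N; rewrite -addSn subnKC // => /key[]//.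
elim: m => [|m IH]; first by rewrite addn0; exact: nz.
by rewrite addnS; case: (key _ IH).
Qed.

Lemma radix_seriesB (R : realType) n (a b : nat -> int) k :
  radix_series R n (fun i => a i - b i) k =
  radix_series R n a k - radix_series R n b k.
Proof.
rewrite /radix_series /series /= -sumrB; apply: eq_bigr => i _.
by rewrite rmorphB mulrBl.
Qed.

Lemma radix_seriesD (R : realType) n (a b : nat -> int) k :
  radix_series R n (fun i => a i + b i) k =
  radix_series R n a k + radix_series R n b k.
Proof.
rewrite /radix_series /series /= -big_split /=; apply: eq_bigr => i _.
by rewrite rmorphD mulrDl.
Qed.

(** * Exchanging digits *)

Lemma base_digits_of (n : nat) (A : set int) a :
  A `<=` [set a | 0 <= a <= n%:Z - 1] -> (forall i, A (a i)) -> base_digits n a.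
Proof. by move=> An aA i; have /= := An _ (aA i); lia. Qed.

Lemma infinite_increasing (P : nat -> Prop) :
  (forall k, exists i, (k <= i)%N /\ P i) ->
  exists f : nat -> nat, {homo f : i j / (i < j)%N} /\ forall j, P (f j).
Proof.
move=> /choice[next nextP].
exists (fun j => next (iter j (fun k => (next k).+1) 0%N)); split.
  apply: homo_ltn; first exact: ltn_trans.
  by move=> j /=; have [] := nextP (next (iter j (fun k => (next k).+1) 0%N)).+1.
by move=> j; have [] := nextP (iter j (fun k => (next k).+1) 0%N).
Qed.

(** Bit j of s decides whether the digits are exchanged at f (2 j), where f
enumerates positions at which a and b differ.  The positions f (2 j + 1) are
never exchanged, which is what makes [radix_zero_rigid] separate the sums. *)
Lemma swapped_representations (R : realType) n (A : set int) a b (x y : R) :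
  (1 < n)%N -> A `<=` [set a | 0 <= a <= n%:Z - 1] ->
  (forall i, A (a i)) -> (forall i, A (b i)) ->
  radix_series R n a @ \oo --> x -> radix_series R n b @ \oo --> y ->
  (forall k, exists i, (k <= i)%N /\ a i <> b i) ->
  exists g : (nat -> bool) -> R * R,
    injective g /\ forall s, representations n A (x + y) (g s).
Proof.
move=> n1 An aA bA ax bY /infinite_increasing[f [f_incr fab]].
have f_inj : injective f.
  by apply: incn_inj; apply: leq_mono.
pose swap (s : nat -> bool) i := `[< exists2 j, i = f j.*2 & s j >].
have swap_even s j : swap s (f j.*2) = s j.
  apply/asboolP/idP => [[k /f_inj/double_inj -> //]|sj]; by exists j.
have swap_odd s j : swap s (f j.*2.+1) = false.
  by apply/asboolPn => -[k /f_inj /(congr1 odd)] /=; rewrite !odd_double.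
pose u s i := if swap s i then b i else a i.
pose v s i := if swap s i then a i else b i.
have uA s i : A (u s i) by rewrite /u; case: ifP.
have vA s i : A (v s i) by rewrite /v; case: ifP.
have cvu s := @is_cvg_radix_series R n (u s) n1 (base_digits_of _ _ _ An (uA s)).
have cvv s := @is_cvg_radix_series R n (v s) n1 (base_digits_of _ _ _ An (vA s)).
exists (fun s => (limn (radix_series R n (u s)), limn (radix_series R n (v s)))).
split; last first.
  move=> s; split => /=; [by exists (u s); split; [exact: uA|exact: cvu]| |].
    by exists (v s); split; [exact: vA|exact: cvv].
  rewrite -limD //; apply: cvg_lim => //.
  rewrite [X in X @ _ --> _](_ : _ = radix_series R n a \+ radix_series R n b).
    exact: cvgD.
  apply/funext => k; rewrite -[LHS]radix_seriesD -[RHS]radix_seriesD.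
  congr (radix_series R n _ k).
  by apply/funext => i; rewrite /u /v; case: ifP => // _; rewrite addrC.
move=> s s' [uu' _]; apply/funext => j; apply: contrapT => ss'.
pose d i := u s i - u s' i.
have d_base : base_digits n d.
  by move=> i; have /= := An _ (uA s i); have /= := An _ (uA s' i); rewrite /d; lia.
have d0 : radix_series R n d @ \oo --> (0 : R).
  rewrite -(subrr (limn (radix_series R n (u s)))) {2}uu'.
  rewrite [X in X @ _ --> _](_ : _ = radix_series R n (u s) \- radix_series R n (u s')).
    by apply: cvgB; [exact: cvu|exact: cvu].
  by apply/funext => k /=; rewrite radix_seriesB.
have dj : d (f j.*2) != 0.
  rewrite subr_eq0 /u !swap_even; apply/eqP.
  by case: (s j) (s' j) ss' => -[] // _ E; apply: (fab j.*2).
have := @radix_zero_rigid R n d _ n1 d_base d0 dj (f j.*2.+1) (ltnW (f_incr _ _ (ltnSn _))).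
by rewrite /d /u !swap_odd subrr eqxx.
Qed.

(** A real number is encoded by its Dedekind cut, read along an enumeration of
the rationals. *)
Lemma real_bits (R : realType) : exists h : R -> nat -> bool, injective h.
Proof.
exists (fun x k => if unpickle k is Some q then ratr (q : rat) < x else false).
suff lt_neq (x y : R) : x < y ->
    (fun k => if unpickle k is Some q then ratr (q : rat) < x else false) <>
    (fun k => if unpickle k is Some q then ratr (q : rat) < y else false).
  by move=> x y xy; apply/eqP; case: ltgtP => // /lt_neq; [move/(_ xy)|move/(_ (esym xy))].
move=> /rat_in_itvoo[q]; rewrite in_itv /= => /andP[xq qy].
by move=> /(congr1 (fun h => h (pickle q))); rewrite /= pickleK qy ltNge ltW.
Qed.

(** Cantor-Bernstein: a representation of z is determined by its first
component. *)
Lemma continuum_representations (R : realType) n (A : set int) (z : R)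
    (g : (nat -> bool) -> R * R) :
  injective g -> (forall s, representations n A z (g s)) ->
  (representations n A z #= [set: R])%card.
Proof.
move=> g_inj gP; have [h h_inj] := real_bits R.
rewrite card_eq_le; apply/andP; split.
  apply/pcard_injP; exists fst => -[x y] [x' y'] /set_mem[_ _ /= xy] /set_mem[_ _ /= xy'] /= xx'.
  by congr (_, _) => //; move: xy; rewrite -xy' xx' => /addrI.
have gh : {in [set: R] &, injective (g \o h)} by move=> x y _ _ /= /g_inj/h_inj.
have /card_eqPle[_ le1] := inj_card_eq gh.
apply: card_le_trans le1 _; apply: subset_card_le => _ [x _ <-]; exact: gP.
Qed.

(** If the digits of x and y agreed from position k on, x - y would be the k-th
partial sum of the difference of the digits, a fraction over n^k. *)
Lemma irrational_difference_continuum (R : realType) n (A : set int) (x y : R) :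
  (1 < n)%N -> A `<=` [set a | 0 <= a <= n%:Z - 1] ->
  cantor_sum_set R n A x -> cantor_sum_set R n A y -> irrational (x - y) ->
  (representations n A (x + y) #= [set: R])%card.
Proof.
move=> n1 An [a [aA ax]] [b [bA bY]] xy_irr.
have n0 := ltnW n1.
suff diff k : exists i, (k <= i)%N /\ a i <> b i.
  have [g [g_inj gP]] := swapped_representations _ _ _ _ _ _ _ n1 An aA bA ax bY diff.
  exact: continuum_representations g_inj gP.
apply: contrapT => /forallNP same; apply: xy_irr.
pose d i := a i - b i.
have dk m : radix_series R n d (k + m)%N = radix_series R n d k.
  elim: m => [|m IH]; first by rewrite addn0.
  rewrite addnS radix_seriesS IH (_ : d _ = 0) ?mul0r ?addr0//.
  apply/eqP; rewrite subr_eq0; apply/eqP; apply: contrapT => ab.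
  by apply: (same (k + m)%N); rewrite leq_addr.
have dxy : radix_series R n d @ \oo --> x - y.
  rewrite [X in X @ _ --> _](_ : _ = radix_series R n a \- radix_series R n b).
    exact: cvgB.
  by apply/funext => j /=; rewrite radix_seriesB.
have : radix_series R n d @ \oo --> radix_series R n d k.
  apply: cvg_near_cst; exists k => // j /= kj.
  by rewrite -(subnKC kj) dk.
move=> /(cvg_unique _ dxy) -> //.
exists ((radix_numerator n d k)%:~R / (n%:R ^+ k)) => //.
by rewrite radix_numeratorE // rmorphM /= fmorphV rmorphXn /= ratr_int ratr_nat.
Qed.

(** * Null sets *)

(** Jordan content zero: coverings by finitely many intervals of one common
half-length r, given by their centres.  The form is chosen because it passes
to affine images by mapping the list of centres. *)
Definition content_zero (R : realType) (X : set R) := forall e : R, 0 < e ->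
  exists (L : seq R) (r : R), [/\ 0 <= r, (size L)%:R * r < e &
    forall x, X x -> exists2 c, c \in L & `|x - c| <= r].

Arguments content_zero {R} X.

Lemma interval_union_measure (R : realType) (L : seq R) (r : R) : 0 <= r ->
  exists E : set R, [/\ measurable E,
    forall x c, c \in L -> `|x - c| <= r -> E x &
    (lebesgue_measure E <= ((size L)%:R * (2 * r))%:E)%E].
Proof.
move=> r0; elim: L => [|c L [E [mE coverE leE]]].
  by exists set0; split => //; rewrite measure0 mul0r.
exists (`[c - r, c + r]%classic `|` E); split; first exact: measurableU.
  move=> x c'; rewrite inE => /predU1P[-> xc|cL xc]; last by right; exact: coverE xc.
  by left; rewrite /= in_itv /=; move: xc; rewrite ler_norml; lra.
apply: le_trans (measureU2 _ _ _) _ => //=.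
rewrite -natr1 mulrDl mul1r EFinD addeC; apply: leeD => //.
rewrite lebesgue_measure_itv /=; case: ifP => _; last by rewrite lee_fin; lra.
by rewrite -EFinB lee_fin; lra.
Qed.

(** The unions of intervals that cover X with total length at most 1/(k+1) have
a measurable intersection, of measure 0. *)
Lemma content_zero_negligible (R : realType) (X : set R) :
  content_zero X -> (@lebesgue_measure R).-negligible X.
Proof.
move=> X0.
have /choice[E EP] k : exists E : set R, [/\ measurable E, X `<=` E &
    (lebesgue_measure E <= (k.+1%:R^-1)%:E)%E].
  have [|L [r [r0 Lr cover]]] := X0 (k.+1%:R^-1 / 2); first by rewrite divr_gt0.
  have [E [mE coverE leE]] := interval_union_measure R L r r0.
  exists E; split => // [x /cover[c cL]|]; first exact: coverE.
  by apply: le_trans leE _; rewrite lee_fin mulrCA mulrC -ler_pdivlMr // ltW.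
have mE k : measurable (E k) by have [] := EP k.
exists (\bigcap_k E k); split; first exact: bigcapT_measurable.
  apply/eqP; rewrite eq_le measure_ge0 andbT; apply/lee_addgt0Pr => e e0.
  rewrite add0e; have [k ke] : exists k, k.+1%:R^-1 <= e.
    exists (Num.bound e^-1); rewrite invf_ple ?posrE // ltW //.
    by apply: lt_trans (archi_boundP _) _; rewrite ?invr_ge0 ?ltW // ltr_nat.
  have [_ _ leE] := EP k; apply: (@le_trans _ _ (lebesgue_measure (E k))); last first.
    by apply: le_trans leE _; rewrite lee_fin.
  apply: le_measure; rewrite ?inE; [exact: bigcapT_measurable|exact: mE|].
  by move=> x; exact.
by move=> x Xx k _; have [_ XE _] := EP k; exact: XE.
Qed.

Lemma content_zero_affine (R : realType) (X : set R) (u v : R) :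
  content_zero X -> content_zero [set u * x + v | x in X].
Proof.
move=> X0 e e0; have u1 : 0 < `|u| + 1 by rewrite ltr_wpDl.
have [|L [r [r0 Lr cover]]] := X0 (e / (`|u| + 1)); first by rewrite divr_gt0.
exists [seq u * c + v | c <- L], ((`|u| + 1) * r); split.
- by rewrite mulr_ge0 // ltW.
- by rewrite size_map mulrCA mulrC -ltr_pdivlMr.
- move=> _ [x /cover[c cL xc] <-]; exists (u * c + v); first exact: map_f.
  rewrite opprD addrACA subrr addr0 -mulrBr normrM.
  by apply: ler_pM => //; rewrite lerDl.
Qed.

Lemma partial_sums_seq (R : realType) n (s : seq int) k :
  exists L : seq R, size L = (size s ^ k)%N /\
    forall a : nat -> int, (forall i, a i \in s) -> radix_series R n a k \in L.
Proof.
elim: k => [|k [L [sL LP]]].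
  by exists [:: 0]; split => // a _; rewrite radix_series0 inE.
exists [seq c + d%:~R * n%:R ^- k.+1 | c <- L, d <- s]; split.
  by rewrite size_allpairs sL expnSr.
move=> a aP; rewrite radix_seriesS; apply/allpairsP => /=.
by exists (radix_series R n a k, a k); split; [exact: (LP a aP)|exact: aP|].
Qed.

(** There are at most (n-1)^k partial sums of length k, each within n^-k of the
full sum, and ((n-1)/n)^k tends to 0. *)
Lemma cantor_content_zero (R : realType) n (A : set int) c :
  (1 < n)%N -> A `<=` [set a | 0 <= a <= n%:Z - 1] ->
  0 <= c <= n%:Z - 1 -> ~ A c -> content_zero (cantor_sum_set R n A).
Proof.
move=> n1 An c_range Ac e e0; have n0 := ltnW n1.
pose s := rem c [seq i%:Z | i <- iota 0 n].
have s_size : size s = n.-1.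
  rewrite size_rem ?size_map ?size_iota //.
  by apply/mapP; exists `|c|%N; [rewrite mem_iota; lia|lia].
have s_mem a : A a -> a \in s.
  move=> Aa; have /= a_range := An _ Aa.
  rewrite mem_rem_uniq ?map_inj_uniq ?iota_uniq //; last by move=> i j [].
  rewrite inE; apply/andP; split; first by apply: contra_notN Ac => /eqP <-.
  by apply/mapP; exists `|a|%N; [rewrite mem_iota; lia|lia].
have q1 : `|n.-1%:R / n%:R : R| < 1.
  rewrite ger0_norm ?divr_ge0 // ltr_pdivrMr ?ltr0n // mul1r ltr_nat; lia.
have /cvgr_dist_lt/(_ _ e0) := cvg_geometric 1 q1.
move=> [k _ /(_ k (leqnn k))]; rewrite /= mul1r sub0r normrN => small.
have [L [L_size LP]] := partial_sums_seq R n s k.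
exists L, (n%:R ^- k); split; first by rewrite invr_ge0 exprn_ge0.
  rewrite L_size s_size natrX -exprVn -exprMn.
  by apply: le_lt_trans small; rewrite ler_norm.
move=> x [a [aA ax]]; exists (radix_series R n a k).
  by apply: LP => i; exact: s_mem.
by apply: radix_remainder => //; exact: base_digits_of aA.
Qed.

(** If x - y = q then x + y = 2 x - q, which lies in an affine image of X, and
there are only countably many q. *)
Lemma rational_difference_negligible (R : realType) (X : set R) :
  content_zero X ->
  (@lebesgue_measure R).-negligible
    [set z | exists x y, [/\ X x, rational (x - y) & x + y = z]].
Proof.
move=> X0.
pose N k : set R := if unpickle k is Some q
   then [set 2 * x + - ratr (q : rat) | x in X] else set0.
have sub : [set z | exists x y, [/\ X x, rational (x - y) & x + y = z]] `<=`
    \bigcup_k N k.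
  move=> _ [x [y [Xx [q _ qxy] <-]]]; exists (pickle q) => //; rewrite /N pickleK.
  by exists x => //; rewrite qxy; ring.
apply: (negligibleS (mu := lebesgue_measure) sub).
apply: negligible_bigcup => k; rewrite /N; case: unpickle => [q|].
  exact/content_zero_negligible/content_zero_affine.
exact: negligible_set0.
Qed.

Lemma countable_negligible (R : realType) (X : set R) :
  countable X -> (@lebesgue_measure R).-negligible X.
Proof.
move=> cX; apply/negligibleP; last exact: countable_lebesgue_measure0.
by apply: countable_measurable => // x; exact: measurable_set1.
Qed.

Lemma irrational_in_interval (R : realType) (d : R) : 0 < d ->
  exists2 t, irrational t & 0 < t < d.
Proof.
move=> d0; apply: contrapT => no_irr.
have sub : `]0, d[%classic `<=` (range ratr : set R).
  move=> t /=; rewrite in_itv /= => td.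
  by apply: contrapT => t_irr; apply: no_irr; exists t.
have : lebesgue_measure (`]0, d[%classic : set R) = 0%E.
  apply: (measure_negligible (mu := lebesgue_measure)); first exact: measurable_itv.
  apply: (negligibleS (mu := lebesgue_measure) sub); apply: countable_negligible.
  by apply: sub_countable (card_image_le _ _) _; exact: countableP.
rewrite lebesgue_measure_itv /= lte_fin d0 oppr0 adde0 => -[] d_eq0.
by move: d0; rewrite d_eq0 ltxx.
Qed.

(** * Almost every point has a representation with irrational difference *)

(** The greedy expansion: with F k the integer part of n^k x, the k-th digit is
F (k+1) - n F k, and the partial sums are the truncations F k / n^k. *)
Lemma full_digits_unit_interval (R : realType) n (A : set int) (x : R) :
  (1 < n)%N -> (forall a, 0 <= a <= n%:Z - 1 -> A a) ->
  0 <= x < 1 -> cantor_sum_set R n A x.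
Proof.
move=> n1 Afull /andP[x0 x1]; have n0 := ltnW n1.
have nR : 0 < n%:R :> R by rewrite ltr0n.
pose F k : int := Num.floor (x * n%:R ^+ k).
have Fl k : (F k)%:~R <= x * n%:R ^+ k by exact: floor_le_tmp.
have Fu k : x * n%:R ^+ k < (F k)%:~R + 1.
  by have /andP[_] := floor_itv (x * n%:R ^+ k); rewrite rmorphD.
pose a k : int := F k.+1 - n%:Z * F k.
have F0 : F 0%N = 0.
  by apply/eqP; rewrite /F expr0 mulr1 floor_eq x0 /= add0r.
have a_range k : 0 <= a k <= n%:Z - 1.
  have lo : n%:Z * F k < F k.+1 + 1.
    rewrite -(ltr_int R) rmorphM rmorphD /= -pmulrn.
    apply: le_lt_trans (Fu k.+1); rewrite exprS mulrCA.
    by rewrite ler_pM2l.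
  have hi : F k.+1 < n%:Z * (F k + 1).
    rewrite -(ltr_int R) rmorphM rmorphD /= -pmulrn.
    apply: le_lt_trans (Fl k.+1) _; rewrite exprS mulrCA.
    by rewrite ltr_pM2l.
  by rewrite /a; lia.
exists a; split; first by move=> i; exact: Afull.
rewrite -/(radix_series R n a).
have SE k : radix_series R n a k = (F k)%:~R * n%:R ^- k.
  rewrite radix_numeratorE //; congr (_%:~R * _).
  by elim: k => [|k IH]; rewrite ?F0 //= IH /a addrC subrK.
apply: (@squeeze_cvgr _ _ _ _ (fun k => x - n%:R ^- k) (fun=> x)).
- near=> k; rewrite SE; have nk : 0 < n%:R ^+ k :> R by rewrite exprn_gt0.
  rewrite ler_pdivrMr // Fl andbT ler_pdivlMr // mulrBl mulVf ?gt_eqF //.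
  by have := Fu k; lra.
- by rewrite -[X in _ --> X]subr0; apply: cvgB; [exact: cvg_cst|exact: cvg_radix_weight].
- exact: cvg_cst.
Unshelve. all: by end_near. Qed.

Theorem theorem1p3 (R : realType) (n : nat) (A : set int)
    (hn : (2 <= n)%N) (hA : n_good R n A) :
  {ae @lebesgue_measure R, forall z : R, `[0, 2]%classic z ->
    (representations n A z #= [set: R])%card}.
Proof.
have [[_ _ An] sum_eq] := hA.
have [Afull|/existsNP[c /not_implyP[c_range Ac]]] :=
  pselect (forall a, 0 <= a <= n%:Z - 1 -> A a).
(* The endpoints 0 and 2 leave no room for an irrational difference. *)
- apply: (@negligibleS _ _ _ lebesgue_measure [set 0; 2]) => [z /= /not_implyP[]|].
    rewrite in_itv /= => z02 z_few; apply: contrapT => /not_orP[z0 z2].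
    have {}z0 : 0 < z by rewrite lt_neqAle eq_sym; move/eqP: z0 => ->; lra.
    have {}z2 : z < 2 by rewrite lt_neqAle; move/eqP: z2 => ->; lra.
    have [|t t_irr t_range] := @irrational_in_interval R (Num.min z (2 - z)).
      by rewrite lt_min z0 subr_gt0.
    move: t_range; rewrite lt_min => t_range.
    apply: z_few.
    rewrite (_ : z = (z + t) / 2 + (z - t) / 2); last by field.
    apply: irrational_difference_continuum => //.
    + by apply: full_digits_unit_interval => //; lra.
    + by apply: full_digits_unit_interval => //; lra.
    + by rewrite (_ : _ - _ = t) //; field.
  exact/countable_negligible/finite_set_countable.
(* Off the exceptional set, any representation has x - y irrational. *)
- have := @rational_difference_negligible R _ (cantor_content_zero R n A c hn An c_range Ac).
  apply: negligibleS => z /= /not_implyP[z02 z_few].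
  have : minkowski_sum (cantor_sum_set R n A) (cantor_sum_set R n A) z by rewrite sum_eq.
  move=> [x Cx [y Cy xyz]]; exists x, y; split => //.
  apply: contrapT => xy_irr; apply: z_few; rewrite -xyz.
  exact: irrational_difference_continuum.
Qed.
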